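(* If a primitive embedding $\iota\colon L_{10}(2)\hookrightarrow L_{26}$ is not of type infty, then the tessellation of $\mathcal{P}(L_{10})$ by induced chambers associated with $\iota$ is simple.
   Context: Lattices. A lattice is a free $\mathbb{Z}$-module of finite rank with a non-degenerate symmetric bilinear form $\langle\,,\,\rangle$ with values in $\mathbb{Z}$; it is even if $\langle v,v\rangle\in 2\mathbb{Z}$ for all $v$, and a lattice of rank $n>1$ is hyperbolic if its signature is $(1,n-1)$. For $n\equiv 2\bmod 8$, $L_n$ is the even unimodular hyperbolic lattice of rank $n$ (unique up to isomorphism). $L(2)$ is the $\mathbb{Z}$-module $L$ with the form multiplied by $2$. An embedding of lattices is an injective form-preserving homomorphism; it is primitive if its cokernel is torsion-free. $\mathrm{O}(L)$ is the isometry group of $L$. $\mathcal{R}(L)$ is the set of $(-2)$-vectors of $L$, i.e. $r\in L$ with $\langle r,r\rangle=-2$. Type infty. A primitive embedding $\iota\colon L_{10}(2)\hookrightarrow L_{26}$ is of type infty if the orthogonal complement of the image of $\iota$ in $L_{26}$ contains no $(-2)$-vectors (such embeddings form a single equivalence class up to the action of $\mathrm{O}(L_{10})$ and $\mathrm{O}(L_{26})$). Chambers. Let $L$ be an even hyperbolic lattice. A positive cone $\mathcal{P}(L)$ is one of the two connected components of $\{x\in L\otimes\mathbb{R}\mid \langle x,x\rangle>0\}$; fix one, and let $\mathrm{O}(L,\mathcal{P})$ be the stabilizer of $\mathcal{P}(L)$ in $\mathrm{O}(L)$. For $v\in L\otimes\mathbb{Q}$ with $\langle v,v\rangle<0$,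 the rational hyperplane $(v)^\perp$ is $\{x\in\mathcal{P}(L)\mid \langle x,v\rangle=0\}$. For a locally finite family $\mathcal{F}$ of rational hyperplanes of $\mathcal{P}(L)$, an $\mathcal{F}$-chamber is the closure in $\mathcal{P}(L)$ of a connected component of $\mathcal{P}(L)\setminus\bigcup_{H\in\mathcal{F}}H$. The space $\mathcal{P}(L)$ is the union of the $\mathcal{F}$-chambers (its tessellation by $\mathcal{F}$-chambers). This tessellation is called simple if there exists a subgroup of $\mathrm{O}(L,\mathcal{P})$ that preserves the family $\mathcal{F}$ of hyperplanes (and hence the set of $\mathcal{F}$-chambers) and acts transitively on the set of $\mathcal{F}$-chambers. Put $\mathcal{R}(L)^\perp:=\{(r)^\perp\mid r\in\mathcal{R}(L)\}$, a locally finite family of rational hyperplanes. Induced chambers. The underlying $\mathbb{Z}$-modules of $L_{10}$ and $L_{10}(2)$ are identified, so $\mathrm{O}(L_{10}(2),\mathcal{P})=\mathrm{O}(L_{10},\mathcal{P})$, and $\mathcal{P}(L_{10}(2))=\mathcal{P}(L_{10})$, chosen so that $\iota\otimes\mathbb{R}$ maps it into $\mathcal{P}(L_{26})$; let $\iota_{\mathcal{P}}\colon\mathcal{P}(L_{10})\hookrightarrow\mathcal{P}(L_{26})$ be the induced inclusion. Put \[ \iota^{*}\mathcal{R}(L_{26})^\perp:=\{\iota_{\mathcal{P}}^{-1}(H)\mid H\in\mathcal{R}(L_{26})^\perp,\ \emptyset\neq\iota_{\mathcal{P}}^{-1}(H)\subsetneq\mathcal{P}(L_{10})\}, \] a locally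 finite family of rational hyperplanes of $\mathcal{P}(L_{10})$. An induced chamber associated with $\iota$ is an $\iota^{*}\mathcal{R}(L_{26})^\perp$-chamber in $\mathcal{P}(L_{10})$; the tessellation by induced chambers is the tessellation for $\mathcal{F}=\iota^{*}\mathcal{R}(L_{26})^\perp$ and $L=L_{10}$. *)

(* Defs.v *)
From HB Require Import structures.
From mathcomp Require Import all_boot all_order all_algebra.
From mathcomp Require Import all_classical all_reals topology normedtype.

Set Implicit Arguments.
Unset Strict Implicit.
Unset Printing Implicit Defensive.

Import Order.TTheory GRing.Theory Num.Theory.
Import numFieldNormedType.Exports.

Local Open Scope classical_set_scope.
Local Open Scope ring_scope.

(* A lattice of rank n is given, in a Z-basis, by its Gram matrix
   G : 'M[int]_n: the Z-module is 'rV[int]_n and <x, y> = x G y^T.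
   Homomorphisms act on row vectors on the right, x |-> x *m f. *)

Definition lform (K : comNzRingType) (n : nat) (G : 'M[K]_n) (x y : 'rV[K]_n) : K :=
  (x *m G *m y^T) 0 0.

Definition is_lattice (n : nat) (G : 'M[int]_n) : Prop :=
  (forall x y, lform G x y = lform G y x) /\
  (forall x, (forall y, lform G x y = 0) -> x = 0).

Definition even_lattice (n : nat) (G : 'M[int]_n) : Prop :=
  forall v, (2 %| lform G v v)%Z.

(* G is the matrix of the map L -> Hom(L, Z) induced by the form. *)
Definition unimodular (n : nat) (G : 'M[int]_n) : Prop := G \in unitmx.

Section Real.
Variable R : realType.

(* L (x) R is 'rV[R]_n; [ext v] is v (x) 1 and [ext A], [act f] are the
   R-linear extensions of a form or a homomorphism. *)
Definition ext (m n : nat) (A : 'M[int]_(m, n)) : 'M[R]_(m, n) :=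
  map_mx intr A.

Definition rform (n : nat) (G : 'M[int]_n) (x y : 'rV[R]_n) : R :=
  lform (ext G) x y.

(* Sylvester: the numbers of positive and negative squares in a real
   diagonalization. *)
Definition has_signature (n : nat) (G : 'M[int]_n) (p q : nat) : Prop :=
  exists (B : 'M[R]_n) (d : 'rV[R]_n),
    [/\ B \in unitmx,
        B *m ext G *m B^T = diag_mx d,
        #|[set i | 0 < d 0 i]%SET| = p &
        #|[set i | d 0 i < 0]%SET| = q].

Definition hyperbolic (n : nat) (G : 'M[int]_n) : Prop :=
  (1 < n)%N /\ has_signature G 1 n.-1.

Definition even_unimodular_hyperbolic (n : nat) (G : 'M[int]_n) : Prop :=
  [/\ is_lattice G, even_lattice G, unimodular G & hyperbolic G].

Definition roots (n : nat) (G : 'M[int]_n) : set 'rV[int]_n :=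
  [set r | lform G r r = -2].

Definition positive_vectors (n : nat) (G : 'M[int]_n) : set 'rV[R]_n :=
  [set x | 0 < rform G x x].

Definition positive_cone (n : nat) (G : 'M[int]_n) (P : set 'rV[R]_n) : Prop :=
  exists2 x, positive_vectors G x &
    P = connected_component (positive_vectors G) x.

Definition act (m n : nat) (f : 'M[int]_(m, n)) (x : 'rV[R]_m) : 'rV[R]_n :=
  x *m ext f.

Definition isometries (n : nat) (G : 'M[int]_n) : set 'M[int]_n :=
  [set g | g \in unitmx /\
           forall x y, lform G (x *m g) (y *m g) = lform G x y].

Definition isometries_cone (n : nat) (G : 'M[int]_n) (P : set 'rV[R]_n) :
    set 'M[int]_n :=
  [set g | isometries G g /\ act g @` P = P].

Definition is_subgroup (n : nat) (Gam A : set 'M[int]_n) : Prop :=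
  [/\ Gam `<=` A, Gam 1%:M,
      forall g h, Gam g -> Gam h -> Gam (g *m h) &
      forall g, Gam g -> Gam (invmx g)].

Definition hyperplane (n : nat) (G : 'M[int]_n) (P : set 'rV[R]_n)
    (v : 'rV[R]_n) : set 'rV[R]_n :=
  [set x | P x /\ rform G x v = 0].

Definition root_hyperplanes (n : nat) (G : 'M[int]_n) (P : set 'rV[R]_n) :
    set (set 'rV[R]_n) :=
  [set hyperplane G P (ext r) | r in roots G].

(* U is the complement of the hyperplanes; the closure of a connected component
   is taken in the subspace P, hence the intersection with P. *)
Definition is_chamber (n : nat) (P : set 'rV[R]_n) (F : set (set 'rV[R]_n))
    (D : set 'rV[R]_n) : Prop :=
  let U := P `\` \bigcup_(H in F) H in
  exists2 x, U x & D = closure (connected_component U x) `&` P.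

Definition simple_tessellation (n : nat) (G : 'M[int]_n) (P : set 'rV[R]_n)
    (F : set (set 'rV[R]_n)) : Prop :=
  exists Gam : set 'M[int]_n,
    [/\ is_subgroup Gam (isometries_cone G P),
        forall g, Gam g -> [set act g @` H | H in F] = F &
        forall D D', is_chamber P F D -> is_chamber P F D' ->
          exists2 g, Gam g & act g @` D = D'].

Definition embedding (m n : nat) (G : 'M[int]_m) (G' : 'M[int]_n)
    (f : 'M[int]_(m, n)) : Prop :=
  injective (fun x : 'rV[int]_m => x *m f) /\
  forall x y, lform G' (x *m f) (y *m f) = lform G x y.

(* The cokernel of f is torsion-free. *)
Definition primitive (m n : nat) (f : 'M[int]_(m, n)) : Prop :=
  forall (k : int) (y : 'rV[int]_n), k != 0 ->
    (exists x : 'rV[int]_m, k *: y = x *m f) ->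
    exists x : 'rV[int]_m, y = x *m f.

Definition primitive_embedding (m n : nat) (G : 'M[int]_m) (G' : 'M[int]_n)
    (f : 'M[int]_(m, n)) : Prop :=
  embedding G G' f /\ primitive f.

Definition type_infty (m n : nat) (G' : 'M[int]_n) (f : 'M[int]_(m, n)) :
    Prop :=
  forall r, (forall x, lform G' (x *m f) r = 0) -> ~ roots G' r.

(* [P `&` act f @^-1` H] is the preimage of H under the restriction P -> P' of
   f (x) R. *)
Definition induced_hyperplanes (m n : nat) (G' : 'M[int]_n)
    (P : set 'rV[R]_m) (P' : set 'rV[R]_n) (f : 'M[int]_(m, n)) :
    set (set 'rV[R]_m) :=
  [set K | exists H, [/\ root_hyperplanes G' P' H, K = P `&` act f @^-1` H,
                         K !=set0 & K `<` P]].

End Real.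

(* Main.v *)
Require Import Defs.
From mathcomp Require Import all_boot all_order all_algebra.
From mathcomp Require Import all_classical all_reals topology normedtype.
From mathcomp Require Import ring lra zify.
Import Order.TTheory GRing.Theory Num.Theory numFieldNormedType.Exports.
Local Open Scope classical_set_scope.
Local Open Scope ring_scope.

Set Implicit Arguments.
Unset Strict Implicit.
Unset Printing Implicit Defensive.

(* Since L10 is unimodular, a (-2)-vector r of L26 projects to f(x) / 2 for some
   x in L10, and the induced hyperplane is the orthogonal of x. If it is
   nonempty and proper then <x, x> < 0, and the component of r orthogonal to
   the image has nonpositive norm -2 - <x, x> / 2; as L10 is even, <x, x> is
   -2 or -4, and -4 would make r lie in the image, hence be f(z) with
   <z, z> = -1. So every induced hyperplane is the mirror of a root x of L10.
   The reflection in x extends to L26 as its product with the reflection in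
   the component of r orthogonal to the image, so it permutes these mirrors.
   Such a family of mirrors is a simple tessellation: the chambers contain
   integral points Y, Z, and a reflection in a mirror separating Y from Z
   decreases the positive integer <Y, Z>. *)

(** * Bilinear forms, Gram matrices and extension of scalars *)

Lemma lformDl (K : comNzRingType) (n : nat) (G : 'M[K]_n) (x y z : 'rV[K]_n) :
  lform G (x + y) z = lform G x z + lform G y z.
Proof. by rewrite /lform !mulmxDl mxE. Qed.

Lemma lformDr (K : comNzRingType) (n : nat) (G : 'M[K]_n) (x y z : 'rV[K]_n) :
  lform G z (x + y) = lform G z x + lform G z y.
Proof. by rewrite /lform linearD /= mulmxDr mxE. Qed.

Lemma lformZl (K : comNzRingType) (n : nat) (G : 'M[K]_n) (a : K)
    (x y : 'rV[K]_n) : lform G (a *: x) y = a * lform G x y.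
Proof. by rewrite /lform -!scalemxAl mxE. Qed.

Lemma lformZr (K : comNzRingType) (n : nat) (G : 'M[K]_n) (a : K)
    (x y : 'rV[K]_n) : lform G x (a *: y) = a * lform G x y.
Proof. by rewrite /lform linearZ /= -scalemxAr mxE. Qed.

Lemma lform0l (K : comNzRingType) (n : nat) (G : 'M[K]_n) (x : 'rV[K]_n) :
  lform G 0 x = 0.
Proof. by rewrite /lform !mul0mx mxE. Qed.

Lemma lform_trmx (K : comNzRingType) (n : nat) (G : 'M[K]_n) (x y : 'rV[K]_n) :
  lform G^T x y = lform G y x.
Proof.
by rewrite /lform -[x *m _ *m _]trmxK mxE !trmx_mul !trmxK mulmxA.
Qed.

Lemma lform_sym (K : comNzRingType) (n : nat) (G : 'M[K]_n) (x y : 'rV[K]_n) :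
  G^T = G -> lform G x y = lform G y x.
Proof. by move=> GT; rewrite -lform_trmx GT. Qed.

Lemma form_gram (n : nat) (G H : 'M[int]_n) :
  (forall x y, lform G x y = lform H x y) -> G = H.
Proof.
have E (K : 'M[int]_n) i j : lform K (delta_mx 0 i) (delta_mx 0 j) = K i j.
  by rewrite /lform -rowE trmx_delta -colE !mxE.
by move=> GH; apply/matrixP => i j; rewrite -!E GH.
Qed.

Lemma lattice_trmx (n : nat) (G : 'M[int]_n) : is_lattice G -> G^T = G.
Proof. by move=> [sG _]; apply: form_gram => x y; rewrite lform_trmx. Qed.

Lemma ext_trmx (R : realType) (m n : nat) (A : 'M[int]_(m, n)) :
  ext R A^T = (ext R A)^T.
Proof. by rewrite /ext map_trmx. Qed.

Lemma ext_mul (R : realType) (m n p : nat) (A : 'M[int]_(m, n))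
    (B : 'M[int]_(n, p)) : ext R (A *m B) = ext R A *m ext R B.
Proof. exact: map_mxM. Qed.

Lemma ext_form (R : realType) (n : nat) (G : 'M[int]_n) (x y : 'rV[int]_n) :
  rform G (ext R x) (ext R y) = (lform G x y)%:~R.
Proof. by rewrite /rform /lform -ext_trmx -!ext_mul mxE. Qed.

(** * Hyperbolic signature: orthogonal coordinates and the reversed Cauchy-Schwarz bound *)

(* The coordinates of x in an orthogonal basis are the entries of x *m C. *)
Definition diagonalizes (R : realType) (n : nat) (G : 'M[int]_n) (C : 'M[R]_n)
    (d : 'I_n -> R) (i0 : 'I_n) : Prop :=
  [/\ C \in unitmx, 0 < d i0, forall i, i != i0 -> d i < 0 &
      forall x y, rform G x y = \sum_i d i * ((x *m C) 0 i * (y *m C) 0 i)].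

(** Signature (1, n - 1) leaves no zero entry: the n - 1 negative indices fill the complement of the
    positive one, [i0]. *)
Lemma hyperbolic_diagonalizes (R : realType) (n : nat) (G : 'M[int]_n) :
  hyperbolic R G -> 
  exists (C : 'M[R]_n) d i0, diagonalizes G C d i0.
Proof.
move=> [n1 [B [d [uB BG pos neg]]]].
have /eqP/cards1P[i0 Pi0] := pos.
have d0 : 0 < d 0 i0.
  by have : i0 \in [set i0]%SET by [rewrite inE]; rewrite -Pi0 inE.
have dn i : i != i0 -> d 0 i < 0.
  move=> ii0; have sub : [set i | d 0 i < 0]%SET \subset [set~ i0]%SET.
    apply/fintype.subsetP => j; rewrite !inE; apply: contraTneq => ->.
    by rewrite -leNgt ltW.
  have /eqP E : [set i | d 0 i < 0]%SET == [set~ i0]%SET.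
    by rewrite eqEcard sub neg cardsC1 card_ord leqnn.
  have : i \in [set~ i0]%SET by rewrite !inE.
  by rewrite -E inE.
exists (invmx B), (d 0), i0; split => //; first by rewrite unitmx_inv.
move=> x y.
have -> : rform G x y =
    ((x *m invmx B) *m (B *m ext R G *m B^T) *m (y *m invmx B)^T) 0 0.
  have BB : B^T *m (invmx B)^T = 1%:M by rewrite -trmx_mul mulVmx // trmx1.
  by rewrite trmx_mul !mulmxA mulmxKV // -(mulmxA (x *m _)) BB mulmx1.
rewrite BG mxE; apply: eq_bigr => i _.
rewrite mul_mx_diag mxE [(y *m _)^T _ _]mxE.
by rewrite mulrAC [RHS]mulrC.
Qed.

(** Lagrange's identity: twice the difference of the two sides is a double sum of squares with
    nonnegative weights. *)
Lemma weighted_cauchy_schwarz (R : realType) (I : finType) (P : pred I)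
    (a u v : I -> R) : (forall i, P i -> 0 <= a i) ->
  (\sum_(i | P i) a i * (u i * v i)) ^+ 2 <=
  (\sum_(i | P i) a i * (u i * u i)) * (\sum_(i | P i) a i * (v i * v i)).
Proof.
move=> a0; rewrite -subr_ge0 -(pmulr_rge0 _ (ltr0n R 2)).
suff -> : 2 * ((\sum_(i | P i) a i * (u i * u i)) *
               (\sum_(i | P i) a i * (v i * v i)) -
               (\sum_(i | P i) a i * (u i * v i)) ^+ 2) =
  \sum_(i | P i) \sum_(j | P j) a i * a j * (u i * v j - u j * v i) ^+ 2.
  apply: sumr_ge0 => i Pi; apply: sumr_ge0 => j Pj.
  by rewrite mulr_ge0 ?sqr_ge0 // mulr_ge0 // a0.
set U := fun i => a i * (u i * u i); set V := fun i => a i * (v i * v i).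
set W := fun i => a i * (u i * v i).
have E i j : a i * a j * (u i * v j - u j * v i) ^+ 2 =
  (U i * V j + V i * U j) - 2 * W i * W j by rewrite /U /V /W; ring.
under [RHS]eq_bigr do under eq_bigr do rewrite E.
under [RHS]eq_bigr do rewrite sumrB big_split /=.
by rewrite sumrB big_split /= -!big_distrlr -big_distrr /=; ring.
Qed.

Lemma rform_sym (R : realType) (n : nat) (G : 'M[int]_n) (x y : 'rV[R]_n) :
  G^T = G -> rform G x y = rform G y x.
Proof. by move=> GT; apply: lform_sym; rewrite -ext_trmx GT. Qed.

(* Cauchy-Schwarz on the negative definite coordinates. *)
Lemma orthogonal_timelike_bound (R : realType) (n : nat) (G : 'M[int]_n)
    (C : 'M[R]_n) (d : 'I_n -> R) (i0 : 'I_n) (x y : 'rV[R]_n) :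
  diagonalizes G C d i0 -> rform G x y = 0 ->
  d i0 * ((y *m C) 0 i0) ^+ 2 * rform G x x <=
  - rform G y y * (d i0 * ((x *m C) 0 i0) ^+ 2 - rform G x x).
Proof.
move=> [_ d0 dn fE] xy0.
have cs := @weighted_cauchy_schwarz R _ (fun i => i != i0) (fun i => - d i)
  (fun i => (x *m C) 0 i) (fun i => (y *m C) 0 i).
have /cs : forall i, i != i0 -> 0 <= - d i.
  by move=> i /dn; rewrite oppr_ge0 => /ltW.
(* The negated form on the negative coordinates is the positive term minus the whole form. With <x,
   y> = 0 the squared term of the inequality is the product of the positive terms of x and y, and
   expanding gives the bound. *)
have S u v : \sum_(i | i != i0) - d i * ((u *m C) 0 i * (v *m C) 0 i) =
    d i0 * ((u *m C) 0 i0 * (v *m C) 0 i0) - rform G u v.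
  rewrite fE [X in _ = _ - X](bigD1 i0) //= opprD addNKr -sumrN.
  by apply: eq_bigr => i _; rewrite mulNr.
by rewrite !S xy0; nra.
Qed.

(** If <y, y> were nonnegative, [orthogonal_timelike_bound] would force the positive coordinate of y
    to vanish; then <y, y> is a sum of nonpositive terms, which must all vanish. *)
Lemma timelike_orthogonal_lt0 (R : realType) (n : nat) (G : 'M[int]_n)
    (x y : 'rV[R]_n) : hyperbolic R G ->
  0 < rform G x x -> rform G x y = 0 -> y != 0 -> rform G y y < 0.
Proof.
move=> /hyperbolic_diagonalizes[C [d [i0 D]]] x0 xy0.
apply: contra_neqT; rewrite -leNgt => y0.
have [uC d0 dn fE] := D.
have B := orthogonal_timelike_bound D xy0.
have xC : rform G x x <= d i0 * ((x *m C) 0 i0) ^+ 2.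
  rewrite fE (bigD1 i0) //= -expr2 gerDl sumr_le0 // => i /dn di.
  by rewrite mulr_le0_ge0 ?(ltW di) // -expr2 sqr_ge0.
have y00 : (y *m C) 0 i0 = 0.
  apply/eqP; rewrite -sqrf_eq0 eq_le sqr_ge0 andbT -(pmulr_rle0 _ d0).
  rewrite -(pmulr_lle0 _ x0); apply: le_trans B _.
  by rewrite mulr_le0_ge0 ?oppr_le0 ?subr_ge0.
have yi i : (y *m C) 0 i = 0.
  have [-> //|ii0] := eqVneq i i0.
  have : 0 <= d i * ((y *m C) 0 i * (y *m C) 0 i).
    move: y0; rewrite fE (bigD1 i0) //= y00 mul0r mulr0 add0r (bigD1 i) //=.
    move=> h; apply: (le_trans h); rewrite gerDl.
    apply: sumr_le0 => j /andP[/dn dj _].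
    by rewrite mulr_le0_ge0 ?(ltW dj) // -expr2 sqr_ge0.
  rewrite (nmulr_rge0 _ (dn i ii0)) -expr2 => h.
  by apply/eqP; rewrite -sqrf_eq0 eq_le h sqr_ge0.
apply: (can_inj (mulmxK uC)); rewrite mul0mx.
by apply/rowP => i; rewrite yi mxE.
Qed.

(** * Continuity, segments and the positive cone *)

Lemma continuous_lform (R : realType) (n : nat) (T : topologicalType)
    (A : 'M[R]_n) (f g : T -> 'rV[R]_n) :
  (forall j, continuous (fun t => f t 0 j)) ->
  (forall j, continuous (fun t => g t 0 j)) ->
  continuous (fun t => lform A (f t) (g t)).
Proof.
move=> cf cg.
rewrite (_ : (fun _ => _) = fun t =>
    \sum_j (\sum_i f t 0 i * A i j) * g t 0 j); last first.
  apply/funext => t; rewrite /lform mxE; apply: eq_bigr => j _.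
  by rewrite !mxE.
apply: continuous_big => [|j _ t]; first exact: add_continuous.
apply: cvgM; last exact: cg.
move: t; apply: continuous_big => [|i _ t]; first exact: add_continuous.
by apply: cvgM; [exact: cf | exact: cvg_cst].
Qed.

Lemma continuous_rform_diag (R : realType) (n : nat) (G : 'M[int]_n) :
  continuous (fun x : 'rV[R]_n => rform G x x).
Proof. by apply: continuous_lform => j; exact: coord_continuous. Qed.

Lemma continuous_rform_r (R : realType) (n : nat) (G : 'M[int]_n)
    (x : 'rV[R]_n) : continuous (rform G x).
Proof.
apply: (@continuous_lform _ _ _ (ext R G) (fun=> x) id) => j.
  exact: cst_continuous.
exact: coord_continuous.
Qed.

Lemma continuous_mulmxr (R : realType) (m n : nat) (A : 'M[R]_(m, n)) :
  continuous (fun x : 'rV[R]_m => x *m A).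
Proof.
rewrite (_ : (fun x : 'rV[R]_m => x *m A) =
             fun x : 'rV[R]_m => \sum_i x 0 i *: row i A); last first.
  by apply/funext => x; rewrite mulmx_sum_row.
apply: continuous_big => [|i _ t]; first exact: add_continuous.
exact: (@cvgZr_tmp R _ _ (nbhs t) _ (fun x => x 0 i) _ (row i A)
  (@coord_continuous R 1 m 0 i t)).
Qed.

Definition segment_point (R : realType) (n : nat) (x y : 'rV[R]_n) (t : R) :=
  (1 - t) *: x + t *: y.

Lemma segment_connected_component (R : realType) (n : nat) (U : set 'rV[R]_n)
    (x y : 'rV[R]_n) :
  (forall t, 0 <= t <= 1 -> U (segment_point x y t)) ->
  connected_component U x y.
Proof.
move=> sU; set S := segment_point x y @` `[0, 1].
have S0 : S x.
  exists 0; first by rewrite /= in_itv /= lexx ler01.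
  by rewrite /segment_point subr0 scale1r scale0r addr0.
have S1 : S y.
  exists 1; first by rewrite /= in_itv /= lexx ler01.
  by rewrite /segment_point subrr scale1r scale0r add0r.
have cS : connected S.
  apply: connected_continuous_connected; first exact: segment_connected.
  apply: continuous_subspaceT => t; apply: cvgD.
    by apply: cvgZr_tmp; apply: cvgB; [exact: cvg_cst | exact: cvg_id].
  by apply: cvgZr_tmp; exact: cvg_id.
apply: (connected_component_max S0) => // _ [t t01 <-]; apply: sU.
by move: t01; rewrite /= in_itv.
Qed.

Lemma positive_segment (R : realType) (n : nat) (G : 'M[int]_n)
    (x y : 'rV[R]_n) (t : R) : G^T = G ->
  0 < rform G x x -> 0 < rform G y y -> 0 < rform G x y -> 0 <= t <= 1 ->
  0 < rform G (segment_point x y t) (segment_point x y t).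
Proof.
move=> GT x0 y0 xy0 /andP[t0 t1]; rewrite /segment_point /rform.
rewrite !(lformDl, lformDr) !(lformZl, lformZr) -!/(rform _ _ _).
rewrite (rform_sym y x GT).
have h1 : 0 <= (1 - t) * (t * rform G x y).
  by rewrite !mulr_ge0 ?subr_ge0 // ltW.
(* The split at 1/2 ensures that the diagonal term required to be strictly positive has a nonzero
   coefficient. *)
have [t12|t12] := leP t (1 / 2).
  have : 0 < (1 - t) ^+ 2 * rform G x x.
    by rewrite mulr_gt0 ?exprn_gt0 // subr_gt0; lra.
  have : 0 <= t ^+ 2 * rform G y y by rewrite mulr_ge0 ?sqr_ge0 // ltW.
  by lra.
have : 0 <= (1 - t) ^+ 2 * rform G x x by rewrite mulr_ge0 ?sqr_ge0 // ltW.
have : 0 < t ^+ 2 * rform G y y by rewrite mulr_gt0 ?exprn_gt0 //; lra.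
by lra.
Qed.

(** A sign change of <x0, .> on the component would, by connectedness, give a vector of positive
    norm orthogonal to x0, which [timelike_orthogonal_lt0] excludes. Conversely, a segment joins x0
    to y. *)
Lemma positive_coneE (R : realType) (n : nat) (G : 'M[int]_n) (x0 : 'rV[R]_n) :
  G^T = G -> hyperbolic R G -> 0 < rform G x0 x0 ->
  connected_component (positive_vectors G) x0 =
  [set y | 0 < rform G y y /\ 0 < rform G x0 y].
Proof.
move=> GT hG q0; apply/seteqP; split => [y [C [Cx CP cC] Cy]|y [qy by_]].
  split; first exact: CP.
  rewrite ltNge; apply/negP => y0.
  have /connected_intervalP iC : connected (rform G x0 @` C).
    apply: connected_continuous_connected => //.
    by apply: continuous_subspaceT; exact: continuous_rform_r.
  have [z Cz z0] : (rform G x0 @` C) 0.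
    apply: (iC (rform G x0 y) (rform G x0 x0)); [by exists y|by exists x0|].
    by rewrite y0 ltW.
  have qz : 0 < rform G z z by exact: CP.
  have zn0 : z != 0 by apply: contraTneq qz => ->; rewrite /rform lform0l ltxx.
  by have := timelike_orthogonal_lt0 hG q0 z0 zn0; rewrite ltNge ltW.
apply: segment_connected_component => t t01.
exact: positive_segment.
Qed.

(** * Local finiteness of the mirrors and density of rational points *)

(** Only finitely many integral vectors have entries in [-N, N], so finitely many neighbourhoods are
    intersected; [dec] enumerates these vectors by a finite type. *)
Lemma near_bounded_int (R : realType) (n : nat) (x : 'rV[R]_n) (N : nat)
    (Q : 'rV[int]_n -> set 'rV[R]_n) :
  (forall r, \forall y \near x, Q r y) ->
  \forall y \near x, forall r : 'rV[int]_n, (forall j, `|r 0 j| <= N%:Z) -> Q r y.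
Proof.
move=> h.
pose dec (f : {ffun 'I_n -> 'I_(N + N).+1}) : 'rV[int]_n :=
  \row_j ((f j)%:Z - N%:Z).
have F := filter_forall (nbhs_filter x) (fun f => h (dec f)).
near=> y => r rN; have hy : forall f, Q (dec f) y by near: y; exact: F.
have <- : dec [ffun j => inord (absz (r 0 j + N%:Z))] = r; last exact: hy.
apply/rowP => j; rewrite mxE ffunE inordK; have := rN j; lia.
Unshelve. all: by end_near.
Qed.

(** Rounding N x down coordinatewise and dividing by N moves each coordinate by less than 1 / N. The
    integral vector Y on the ray is kept, since positive scaling changes neither signs nor the
    cone. *)
Lemma near_integral (R : realType) (n : nat) (x : 'rV[R]_n)
    (S : set 'rV[R]_n) : nbhs x S ->
  exists2 a : R, 0 < a & exists Y : 'rV[int]_n, S (a *: ext R Y).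
Proof.
move=> /nbhs_ballP[e /= e0 eS].
set N := Num.bound e^-1; have Ne : e^-1 < N%:R.
  by apply: archi_boundP; rewrite invr_ge0 ltW.
have N0 : 0 < (N%:R : R) by apply: lt_trans Ne; rewrite invr_gt0.
exists N%:R^-1; first by rewrite invr_gt0.
exists (\row_j Num.floor (N%:R * x 0 j)); apply: eS; split=> // i j.
rewrite ord1 !mxE; set f := Num.floor _.
have f1 : f%:~R <= N%:R * x 0 j by exact: floor_le.
have f2 : N%:R * x 0 j < (f + 1)%:~R by exact: floorD1_gt.
have xE : x 0 j - N%:R^-1 * f%:~R = N%:R^-1 * (N%:R * x 0 j - f%:~R).
  by rewrite mulrBr mulKf // gt_eqF.
rewrite /ball /= xE ger0_norm ?mulr_ge0 ?invr_ge0 ?(ltW N0) ?subr_ge0 //.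
rewrite -ltr_pdivlMl ?invr_gt0 // invrK.
have : 1 < N%:R * e by rewrite -ltr_pdivrMr // div1r.
by move: f2; rewrite intrD; lra.
Qed.

(** Near x the norm of y stays above [del] and the square of its positive coordinate below [M]. As
    <r, r> = -2, [orthogonal_timelike_bound] then bounds the positive coordinate of r, and the norm
    equation bounds the others. *)
Lemma near_roots_bounded (R : realType) (n : nat) (G : 'M[int]_n)
    (x : 'rV[R]_n) : hyperbolic R G -> 0 < rform G x x ->
  exists N : nat, \forall y \near x, forall r, Defs.roots G r ->
    rform G y (ext R r) = 0 -> forall j, `|r 0 j| <= N%:Z.
Proof.
move=> /hyperbolic_diagonalizes[C [d [i0 D]]] qx.
have [uC d0 dn fE] := D.
pose del := rform G x x / 2; have del0 : 0 < del by rewrite divr_gt0.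
pose M : R := (x *m C) 0 i0 ^+ 2 + 1.
have M0 : 0 < M by rewrite ltr_wpDl ?sqr_ge0.
pose K0 := 2 * M / del.
have K00 : 0 <= K0 by rewrite divr_ge0 ?(ltW del0) // mulr_ge0 // ltW.
(* [K] bounds the squared coordinates of r; the summand 1 makes it also bound their absolute
   values. *)
pose K := 1 + K0 + \sum_i (2 + d i0 * K0) / `|d i|.
(* The passage back to standard coordinates through [invmx C]. *)
pose K2 := K * \sum_i \sum_j `|invmx C i j|.
exists (Num.bound K2).
have near1 : \forall y \near x, del < rform G y y.
  have dx : del < rform G x x by rewrite /del ltr_pdivrMr //; move: qx; lra.
  exact: (continuous_rform_diag (lt_nbhsr dx)).
have near2 : \forall y \near x, (y *m C) 0 i0 ^+ 2 < M.
  have cont : {for x, continuous (fun y : 'rV[R]_n => (y *m C) 0 i0 ^+ 2)}.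
    have cC := @continuous_comp _ _ _ _ (fun z : 'rV[R]_n => z 0 i0) x
      (@continuous_mulmxr R n n C x) (@coord_continuous R 1 n 0 i0 (x *m C)).
    by have := continuousM cC cC.
  have xM : (x *m C) 0 i0 ^+ 2 < M by rewrite ltrDl.
  exact: (cont _ (lt_nbhsl xM)).
near=> y => r rr yr j.
have qy : del < rform G y y by near: y.
have yM : (y *m C) 0 i0 ^+ 2 < M by near: y.
have qr : rform G (ext R r) (ext R r) = -2 by rewrite ext_form rr.
have B := orthogonal_timelike_bound D yr.
rewrite qr opprK in B.
set rho := ext R r *m C in B *.
have rho0 : rho 0 i0 ^+ 2 <= K0.
  rewrite /K0 ler_pdivlMr // -(ler_pM2l d0).
  have : d i0 * (rho 0 i0 ^+ 2 * del) <= d i0 * (rho 0 i0 ^+ 2 * rform G y y).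
    by rewrite ler_pM2l // ler_wpM2l ?sqr_ge0 // ltW.
  have : d i0 * (y *m C) 0 i0 ^+ 2 <= d i0 * M by rewrite ler_pM2l // ltW.
  by move: B; lra.
have tK k : 0 <= (2 + d i0 * K0) / `|d k|.
  by rewrite divr_ge0 // addr_ge0 // mulr_ge0 // ltW.
have rhoi i : rho 0 i ^+ 2 <= K.
  have sum0 : 0 <= \sum_i (2 + d i0 * K0) / `|d i|.
    by apply: sumr_ge0.
  have [->|ii0] := eqVneq i i0; first by rewrite /K; lra.
  have hi : rho 0 i ^+ 2 <= (2 + d i0 * K0) / `|d i|.
    have di := dn i ii0; rewrite ltr0_norm // ler_pdivlMr ?oppr_gt0 //.
    have : \sum_(k | (k != i0) && (k != i)) d k * (rho 0 k * rho 0 k) <= 0.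
      apply: sumr_le0 => k /andP[/dn dk _].
      by rewrite mulr_le0_ge0 ?(ltW dk) // -expr2 sqr_ge0.
    move: qr; rewrite fE (bigD1 i0) //= (bigD1 i) //= -/rho -!expr2.
    have : d i0 * rho 0 i0 ^+ 2 <= d i0 * K0 by rewrite ler_pM2l.
    by lra.
  have : \sum_(k | k != i) (2 + d i0 * K0) / `|d k| >= 0.
    by apply: sumr_ge0.
  by move: hi; rewrite /K [X in _ <= _ + X](bigD1 i) //=; lra.
have rhoK i : `|rho 0 i| <= K.
  have := rhoi i; have := sqr_ge0 (`|rho 0 i| - 1).
  rewrite -(@real_normK _ (rho 0 i)) ?num_real //.
  have : 1 <= K by rewrite /K -addrA lerDl addr_ge0 // sumr_ge0.
  by nra.
have K1 : 0 <= K by apply: le_trans (rhoK i0).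
have rE : (r 0 j)%:~R = \sum_i rho 0 i * invmx C i j :> R.
  have -> : (r 0 j)%:~R = (rho *m invmx C) 0 j by rewrite mulmxK // mxE.
  by rewrite mxE.
have : `|(r 0 j)%:~R : R| <= K2.
  rewrite rE; apply: le_trans (ler_norm_sum _ _ _) _.
  rewrite /K2 mulr_sumr; apply: ler_sum => i _; rewrite normrM.
  apply: ler_pM => //; rewrite (bigD1 j) //= lerDl.
  by apply: sumr_ge0.
move=> h; have h2 : `|(r 0 j)%:~R : R| < (Num.bound K2)%:R.
  by apply: (le_lt_trans h); apply: archi_boundP; exact: (le_trans _ h).
by move: h2; rewrite -intr_norm pmulrn ltr_int => /ltW.
Unshelve. all: by end_near.
Qed.

Lemma rform_segment (R : realType) (n : nat) (G : 'M[int]_n)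
    (x y z : 'rV[R]_n) (t : R) :
  rform G (segment_point x y t) z = (1 - t) * rform G x z + t * rform G y z.
Proof. by rewrite /rform lformDl !lformZl. Qed.

Lemma ball_segment (R : realType) (n : nat) (x y : 'rV[R]_n) (e t : R) :
  0 < e -> ball x e y -> 0 <= t <= 1 -> ball x e (segment_point x y t).
Proof.
move=> e0 [_ xy] /andP[t0 t1]; split=> // i j.
have := xy i j; rewrite /ball /= !mxE => h.
have -> : x i j - ((1 - t) * x i j + t * y i j) = t * (x i j - y i j) by ring.
rewrite normrM ger0_norm //; apply: le_lt_trans h.
by rewrite ler_piMl.
Qed.

Lemma segment_sign_change (R : realType) (n : nat) (G : 'M[int]_n)
    (x y z : 'rV[R]_n) : rform G x z != 0 ->
  ~~ (0 < rform G x z * rform G y z) ->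
  exists2 t, 0 <= t <= 1 & rform G (segment_point x y t) z = 0.
Proof.
set a := rform G x z; set b := rform G y z => a0; rewrite -leNgt => ab.
have ab0 : a - b != 0.
  apply: contraTneq ab => /eqP; rewrite subr_eq0 => /eqP <-.
  by rewrite -ltNge -expr2 exprn_even_gt0.
have d0 : 0 < (a - b) ^+ 2 by rewrite exprn_even_gt0.
have aE : a / (a - b) = a * (a - b) / (a - b) ^+ 2 by field.
(* The zero of the affine function (1 - t) a + t b. *)
exists (a / (a - b)); last by rewrite rform_segment -/a -/b; field.
rewrite aE divr_ge0 ?(ltW d0) //=; last by move: (sqr_ge0 a); nra.
by rewrite ler_pdivrMr // mul1r; move: (sqr_ge0 b); nra.
Qed.

(** If r took opposite signs at x and y, or vanished at y, its mirror would meet the segment from x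
    to y. Inside a small ball only roots with bounded entries have such mirrors, and each of these
    finitely many keeps its sign near x. *)
Lemma near_roots_sign (R : realType) (n : nat) (G : 'M[int]_n) (x : 'rV[R]_n)
    (A : set 'rV[int]_n) : hyperbolic R G -> 0 < rform G x x ->
  A `<=` Defs.roots G -> (forall r, A r -> rform G x (ext R r) != 0) ->
  \forall y \near x, forall r, A r ->
    0 < rform G x (ext R r) * rform G y (ext R r).
Proof.
move=> hG qx AG xA; have [N hN] := near_roots_bounded hG qx.
have /nbhs_ballP[e /= e0 eN] := hN.
have hb : forall r : 'rV[int]_n, \forall y \near x, A r ->
    0 < rform G x (ext R r) * rform G y (ext R r).
  move=> r; have [Ar|nAr] := pselect (A r); last by near=> y => /nAr.
  have cont := @continuous_lform R n _ (ext R G) id (fun=> ext R r)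
    (fun j => @coord_continuous R 1 n 0 j) (fun j => @cst_continuous _ _ _).
  have s0 : 0 < rform G x (ext R r) * rform G x (ext R r).
    by rewrite -expr2 exprn_even_gt0 // xA.
  have cM := continuousM (@cst_continuous _ _ (rform G x (ext R r)) x) (cont x).
  have hs := cM _ (lt_nbhsr s0).
  by near=> y => _; near: y; exact: hs.
have hb2 := near_bounded_int N hb.
have hball := nbhsx_ballx x e e0.
near=> y => r Ar; have ye : ball x e y by near: y; exact: hball.
have hy : forall r : 'rV[int]_n, (forall j, `|r 0 j| <= N%:Z) ->
  A r -> 0 < rform G x (ext R r) * rform G y (ext R r) by near: y; exact: hb2.
apply/negPn/negP => h; have [t t01 t0] := segment_sign_change (xA r Ar) h.
have rN := eN _ (ball_segment e0 ye t01) r (AG r Ar) t0.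
by move/negP: h; apply; exact: hy.
Unshelve. all: by end_near.
Qed.

(** * Action of isometries on hyperplanes and chambers *)

Lemma act1 (R : realType) (n : nat) (x : 'rV[R]_n) : act 1%:M x = x.
Proof. by rewrite /act /ext map_mx1 mulmx1. Qed.

Lemma act_mul (R : realType) (n : nat) (g h : 'M[int]_n) (x : 'rV[R]_n) :
  act (g *m h) x = act h (act g x).
Proof. by rewrite /act ext_mul mulmxA. Qed.

Lemma actK (R : realType) (n : nat) (g : 'M[int]_n) :
  g \in unitmx -> cancel (@act R n n g) (act (invmx g)).
Proof. by move=> ug x; rewrite -act_mul mulmxV // act1. Qed.

Lemma actKV (R : realType) (n : nat) (g : 'M[int]_n) :
  g \in unitmx -> cancel (@act R n n (invmx g)) (act g).
Proof. by move=> ug x; rewrite -act_mul mulVmx // act1. Qed.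

Lemma act_ext (R : realType) (m n : nat) (f : 'M[int]_(m, n))
    (x : 'rV[int]_m) : act f (ext R x) = ext R (x *m f).
Proof. by rewrite ext_mul. Qed.

(** Compatibility on integral vectors is an identity of Gram matrices, hence extends to real
    vectors. *)
Lemma rform_act (R : realType) (m n : nat) (G : 'M[int]_m) (H : 'M[int]_n)
    (f : 'M[int]_(m, n)) (x y : 'rV[R]_m) :
  (forall u v, lform H (u *m f) (v *m f) = lform G u v) ->
  rform H (act f x) (act f y) = rform G x y.
Proof.
move=> fE; have <- : f *m H *m f^T = G.
  by apply: form_gram => u v; rewrite -fE /lform trmx_mul !mulmxA.
by rewrite /rform /lform /act !ext_mul ext_trmx trmx_mul !mulmxA.
Qed.

Lemma isometries_inv (n : nat) (G g : 'M[int]_n) :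
  isometries G g -> isometries G (invmx g).
Proof.
move=> [ug gE]; split=> [|x y]; first by rewrite unitmx_inv.
by rewrite -gE !mulmxKV.
Qed.

Lemma isometries_mul (n : nat) (G g h : 'M[int]_n) :
  isometries G g -> isometries G h -> isometries G (g *m h).
Proof.
move=> [ug gE] [uh hE]; split=> [|x y]; first by rewrite unitmx_mul ug.
by rewrite !mulmxA hE gE.
Qed.

Lemma isometries_cone_inv (R : realType) (n : nat) (G g : 'M[int]_n)
    (P : set 'rV[R]_n) : isometries_cone G P g -> isometries_cone G P (invmx g).
Proof.
move=> [ig gP]; split; first exact: isometries_inv.
have ug := ig.1; rewrite -[in LHS]gP; apply/seteqP.
split=> [_ [_ [x Px <-] <-]|x Px]; first by rewrite actK.
by exists (act g x); [exists x | rewrite actK].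
Qed.

Lemma isometries_cone_mul (R : realType) (n : nat) (G g h : 'M[int]_n)
    (P : set 'rV[R]_n) :
  isometries_cone G P g -> isometries_cone G P h ->
  isometries_cone G P (g *m h).
Proof.
move=> [ig gP] [ih hP]; split; first exact: isometries_mul.
rewrite -[in RHS]hP -[in RHS]gP image_comp.
by apply: eq_imagel => x _; rewrite act_mul.
Qed.

Lemma image_hyperplane (R : realType) (n : nat) (G g : 'M[int]_n)
    (P : set 'rV[R]_n) (v : 'rV[R]_n) : isometries_cone G P g ->
  act g @` hyperplane G P v = hyperplane G P (act g v).
Proof.
move=> [[ug gE] gP]; apply/seteqP; split=> [_ [x [Px xv] <-]|y [Py yv]].
  by split; [rewrite -gP; exists x | rewrite (rform_act _ _ gE)].
move: Py yv; rewrite -{1}gP => -[x Px <-]; rewrite (rform_act _ _ gE) => xv.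
by exists x.
Qed.

(** The largest group that can serve as [Gam] in [simple_tessellation]. *)
Definition family_stabilizer (R : realType) (n : nat) (G : 'M[int]_n)
    (P : set 'rV[R]_n) (F : set (set 'rV[R]_n)) : set 'M[int]_n :=
  [set g | isometries_cone G P g /\ [set act g @` H | H in F] = F].

Lemma is_subgroup_family_stabilizer (R : realType) (n : nat) (G : 'M[int]_n)
    (P : set 'rV[R]_n) (F : set (set 'rV[R]_n)) :
  is_subgroup (family_stabilizer G P F) (isometries_cone G P).
Proof.
split=> [g []//| |g h [ig gF] [ih hF]|g [ig gF]].
- have i1 (S : set 'rV[R]_n) : act 1%:M @` S = S.
    by rewrite -[RHS]image_id; apply: eq_imagel => x _; rewrite act1.
  split; last by rewrite -[RHS]image_id; apply: eq_imagel => H _; exact: i1.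
  by split; [split=> [|x y]; rewrite ?unitmx1 ?mulmx1 | exact: i1].
- split; first exact: isometries_cone_mul.
  rewrite -[in RHS]hF -[in RHS]gF image_comp; apply: eq_imagel => H _ /=.
  by rewrite image_comp; apply: eq_imagel => x _; rewrite act_mul.
- split; first exact: isometries_cone_inv.
  have gK (S : set 'rV[R]_n) : act (invmx g) @` (act g @` S) = S.
    rewrite image_comp -[RHS]image_id; apply: eq_imagel => x _ /=.
    by rewrite actK //; case: ig => -[].
  rewrite -[in LHS]gF image_comp -[RHS]image_id; apply: eq_imagel => H _.
  exact: gK.
Qed.

Lemma family_stabilizer_complement (R : realType) (n : nat) (G g : 'M[int]_n)
    (P : set 'rV[R]_n) (F : set (set 'rV[R]_n)) (x : 'rV[R]_n) :
  family_stabilizer G P F g -> (P `\` \bigcup_(H in F) H) x ->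
  (P `\` \bigcup_(H in F) H) (act g x).
Proof.
move=> [[[ug _] gP] gF] [Px xF]; split; first by rewrite -gP; exists x.
move=> [H]; rewrite -gF => -[H' FH' <-] [z H'z zx]; apply: xF.
by exists H' => //; rewrite -(can_inj (actK ug) zx).
Qed.

(** Since g is continuous and preserves the complement of the hyperplanes, it sends the component of
    x into that of its image, and limit points to limit points. *)
Lemma family_stabilizer_chamber_sub (R : realType) (n : nat)
    (G g : 'M[int]_n) (P : set 'rV[R]_n) (F : set (set 'rV[R]_n))
    (x y : 'rV[R]_n) (U := P `\` \bigcup_(H in F) H) :
  family_stabilizer G P F g -> U x ->
  (closure (connected_component U x) `&` P) y ->
  (closure (connected_component U (act g x)) `&` P) (act g y).
Proof.
move=> gF Ux [yC Py]; have [[_ gP] _] := gF; split; last by rewrite -gP; exists y.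
have cg : continuous (@act R n n g) by exact: continuous_mulmxr.
have CS : act g @` connected_component U x `<=` connected_component U (act g x).
  apply: connected_component_max.
  - by exists x => //; exact: connected_component_refl.
  - move=> _ [z /connected_component_sub zU <-].
    exact: (family_stabilizer_complement gF zU).
  - apply: connected_continuous_connected; first exact: component_connected.
    exact: continuous_subspaceT.
move=> B /cg /yC [z [Cz Bz]]; exists (act g z); split=> //.
by apply: CS; exists z.
Qed.

Lemma family_stabilizer_chamber (R : realType) (n : nat)
    (G g : 'M[int]_n) (P : set 'rV[R]_n) (F : set (set 'rV[R]_n))
    (x : 'rV[R]_n) (U := P `\` \bigcup_(H in F) H) :
  family_stabilizer G P F g -> U x ->
  act g @` (closure (connected_component U x) `&` P) =
  closure (connected_component U (act g x)) `&` P.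
Proof.
move=> gF Ux; have ug : g \in unitmx by case: gF => -[[]].
apply/seteqP; split=> [_ [y yC <-]|y yC].
  exact: (family_stabilizer_chamber_sub gF Ux yC).
exists (act (invmx g) y); last by rewrite actKV.
have [_ _ _ ginv] := is_subgroup_family_stabilizer G P F.
rewrite -[in closure _](actK ug x).
have gUx := family_stabilizer_complement gF Ux.
exact: (family_stabilizer_chamber_sub (ginv g gF) gUx yC).
Qed.

(** * Reflections in roots *)

(** Acts on row vectors by x |-> x + <x, r> r, the orthogonal reflection in r when <r, r> = -2. *)
Definition reflection (n : nat) (G : 'M[int]_n) (r : 'rV[int]_n) : 'M[int]_n :=
  1%:M + G *m r^T *m r.

Lemma mul_reflection (n : nat) (G : 'M[int]_n) (r x : 'rV[int]_n) :
  x *m reflection G r = x + lform G x r *: r.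
Proof.
by rewrite mulmxDr mulmx1 !mulmxA [x *m G *m r^T]mx11_scalar mul_scalar_mx.
Qed.

Lemma act_reflection (R : realType) (n : nat) (G : 'M[int]_n)
    (r : 'rV[int]_n) (x : 'rV[R]_n) :
  act (reflection G r) x = x + rform G x (ext R r) *: ext R r.
Proof.
rewrite /act /reflection {1}/ext map_mxD map_mx1 mulmxDr mulmx1 -/(ext R _).
rewrite !ext_mul ext_trmx !mulmxA [x *m ext R G *m _]mx11_scalar.
by rewrite mul_scalar_mx.
Qed.

Lemma reflection_isometry (n : nat) (G : 'M[int]_n) (r : 'rV[int]_n) :
  G^T = G -> Defs.roots G r -> isometries G (reflection G r).
Proof.
move=> GT rr; split.
  have : reflection G r *m reflection G r = 1%:M.
    apply/row_matrixP => i; rewrite !rowE mulmxA mulmx1 !mul_reflection.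
    rewrite lformDl lformZl rr -addrA -scalerDl.
    by rewrite (_ : _ + (_ + _) = 0) ?scale0r ?addr0 //; ring.
  by case/mulmx1_unit.
move=> x y; rewrite !mul_reflection !(lformDl, lformDr) !(lformZl, lformZr) rr.
by rewrite (lform_sym r y GT); ring.
Qed.

Lemma positive_cone_mem (R : realType) (n : nat) (G : 'M[int]_n)
    (P : set 'rV[R]_n) (z : 'rV[R]_n) : G^T = G -> hyperbolic R G ->
  positive_cone G P -> P z ->
  P = [set y | 0 < rform G y y /\ 0 < rform G z y].
Proof.
move=> GT hG [x0 _ ->] x0z.
rewrite (same_connected_component x0z) positive_coneE //.
exact: connected_component_sub x0z.
Qed.

(** One vector staying in P suffices: P is cut out by products with x and equally by products with
    its image, and g preserves products. *)
Lemma isometry_cone (R : realType) (n : nat) (G g : 'M[int]_n)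
    (P : set 'rV[R]_n) (x : 'rV[R]_n) : G^T = G -> hyperbolic R G ->
  positive_cone G P -> isometries G g -> P x -> P (act g x) ->
  isometries_cone G P g.
Proof.
move=> GT hG hP ig Px Pgx; split=> //; have [ug gE] := ig.
have Pg y : P y <-> P (act g y).
  rewrite [in X in X <-> _](positive_cone_mem GT hG hP Px).
  rewrite [in X in _ <-> X](positive_cone_mem GT hG hP Pgx) /=.
  by rewrite !(rform_act _ _ gE).
apply/seteqP; split=> [_ [y /Pg Py <-//]|y Py].
by exists (act (invmx g) y); [apply/Pg; rewrite actKV | rewrite actKV].
Qed.

Lemma reflection_cone (R : realType) (n : nat) (G : 'M[int]_n)
    (P : set 'rV[R]_n) (r : 'rV[int]_n) : G^T = G -> hyperbolic R G ->
  positive_cone G P -> Defs.roots G r -> isometries_cone G P (reflection G r).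
Proof.
move=> GT hG hP rr; have ir := reflection_isometry GT rr.
have [x x0 PE] := hP.
have Px : P x by rewrite PE; exact: connected_component_refl.
apply: (isometry_cone GT hG hP ir Px).
rewrite (positive_cone_mem GT hG hP Px) /= (rform_act _ _ ir.2); split=> //.
(* The product of x with its reflection is <x, x> + <x, r>^2. *)
rewrite act_reflection /rform lformDr lformZr -!/(rform _ _ _) -expr2.
by rewrite ltr_pwDl ?sqr_ge0.
Qed.

(** * Chambers described by the signs of roots *)

(** Along the segment from x to y the product with r is a convex combination of two nonzero numbers
    of the same sign, so no mirror is met. *)
Lemma same_sign_component (R : realType) (n : nat) (G : 'M[int]_n)
    (P : set 'rV[R]_n) (A : set 'rV[int]_n) (x y : 'rV[R]_n) :
  G^T = G -> hyperbolic R G -> positive_cone G P -> P x -> P y ->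
  (forall r, A r -> 0 < rform G x (ext R r) * rform G y (ext R r)) ->
  connected_component
    (P `\` \bigcup_(H in [set hyperplane G P (ext R r) | r in A]) H) x y.
Proof.
move=> GT hG hP Px Py xyA; apply: segment_connected_component => t t01.
have PE := positive_cone_mem GT hG hP Px.
have qx : 0 < rform G x x by move: (Px); rewrite PE => -[].
have [qy xy] : 0 < rform G y y /\ 0 < rform G x y by move: (Py); rewrite {1}PE.
split.
  rewrite PE; split; first exact: positive_segment.
  rewrite rform_sym // rform_segment (rform_sym y x) //.
  move/andP: t01 => [t0 t1].
  have [->|tn1] := eqVneq t 1; first by rewrite subrr mul0r add0r mul1r.
  rewrite ltr_pwDl ?mulr_ge0 ?(ltW xy) // mulr_gt0 // subr_gt0.
  by rewrite lt_neqAle tn1.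
move=> [_ [r Ar <-] [_]]; rewrite rform_segment => /eqP; apply/negP.
have := xyA r Ar; set a := rform G x _; set b := rform G y _ => ab.
apply: contraTneq ab => E; rewrite -leNgt; move/andP: t01 => [t0 t1].
have aE : (1 - t) * a ^+ 2 + t * (a * b) = 0.
  by transitivity (a * ((1 - t) * a + t * b)); [ring | rewrite E mulr0].
rewrite leNgt; apply/negP => ab.
have a2 : 0 < a ^+ 2.
  by rewrite exprn_even_gt0 //; apply: contraTneq ab => ->; rewrite mul0r ltxx.
have [t12|t12] := leP t (1 / 2).
  have : 0 < (1 - t) * a ^+ 2 by rewrite mulr_gt0 // subr_gt0; lra.
  have : 0 <= t * (a * b) by rewrite mulr_ge0 // ltW.
  by lra.
have : 0 <= (1 - t) * a ^+ 2 by rewrite mulr_ge0 ?subr_ge0 // ltW.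
have : 0 < t * (a * b) by rewrite mulr_gt0 //; lra.
by lra.
Qed.

(** The cone and sign conditions hold near x and are invariant under positive scaling, so a rational
    point near x can be replaced by an integral one. *)
Lemma integral_point (R : realType) (n : nat) (G : 'M[int]_n)
    (P : set 'rV[R]_n) (A : set 'rV[int]_n) (x : 'rV[R]_n) :
  G^T = G -> hyperbolic R G -> positive_cone G P -> A `<=` Defs.roots G ->
  P x -> (forall r, A r -> rform G x (ext R r) != 0) ->
  exists Y : 'rV[int]_n, P (ext R Y) /\
    forall r, A r -> 0 < rform G x (ext R r) * rform G (ext R Y) (ext R r).
Proof.
move=> GT hG hP AG Px xA; have PE := positive_cone_mem GT hG hP Px.
have qx : 0 < rform G x x by move: Px; rewrite PE => -[].
have n1 := near_roots_sign hG qx AG xA.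
have n2 : nbhs x [set y | 0 < rform G y y] :=
  continuous_rform_diag (lt_nbhsr qx).
have n3 : nbhs x [set y | 0 < rform G x y] :=
  @continuous_rform_r R n G x x _ (lt_nbhsr qx).
have [a a0 [Y [[qY xY] YA]]] := near_integral (filterI (filterI n2 n3) n1).
exists Y; split.
  rewrite PE; split; last by move: xY; rewrite /= /rform lformZr pmulr_rgt0.
  by move: qY; rewrite /= /rform lformZl lformZr !pmulr_rgt0.
move=> r /YA; rewrite /rform lformZl -!/(rform _ _ _).
by rewrite mulrCA pmulr_rgt0.
Qed.

(** * Transitivity on the chambers cut out by a reflection-stable set of roots *)

Section Transitivity.
Variables (R : realType) (n : nat) (G : 'M[int]_n) (P : set 'rV[R]_n).
Variable A : set 'rV[int]_n.
Hypotheses (GT : G^T = G) (hG : hyperbolic R G) (hP : positive_cone G P).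
Hypothesis AG : A `<=` Defs.roots G.
Hypothesis AA : forall x y, A x -> A y -> A (y + lform G y x *: x).

Let F := [set hyperplane G P (ext R r) | r in A].
Let U := P `\` \bigcup_(H in F) H.

(** By [AA] the reflection maps mirrors of the family to mirrors of the family; being an involution,
    it reaches all of them. *)
Lemma reflection_stabilizer (r : 'rV[int]_n) :
  A r -> family_stabilizer G P F (reflection G r).
Proof.
move=> Ar; have rP := reflection_cone GT hG hP (AG Ar); split=> //.
have sub : [set act (reflection G r) @` H | H in F] `<=` F.
  move=> _ [_ [s As <-] <-]; exists (s *m reflection G r).
    by rewrite mul_reflection; exact: AA.
  by rewrite image_hyperplane // act_ext.
apply/seteqP; split=> // _ [s As <-].
exists (hyperplane G P (ext R (s *m reflection G r))).
  by exists (s *m reflection G r) => //; rewrite mul_reflection; exact: AA.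
rewrite image_hyperplane // act_ext; congr hyperplane; congr ext.
rewrite !mul_reflection lformDl lformZl (AG Ar) -addrA -scalerDl.
by rewrite (_ : _ + (_ + _) = 0) ?scale0r ?addr0 //; ring.
Qed.

Lemma complement_sign (x : 'rV[R]_n) (r : 'rV[int]_n) :
  U x -> A r -> rform G x (ext R r) != 0.
Proof.
move=> [Px xF] Ar; apply/eqP => xr; apply: xF.
by exists (hyperplane G P (ext R r)); [exists r | split].
Qed.

(* A reflection in a root separating Y from Z decreases the positive integer
   <Y, Z>. *)
Lemma stabilizer_same_sign (Y Z : 'rV[int]_n) : U (ext R Y) -> U (ext R Z) ->
  exists2 g, family_stabilizer G P F g &
    forall r, A r -> 0 < lform G (Y *m g) r * lform G Z r.
Proof.
move=> UY UZ; have [k] := ubnP (absz (lform G Y Z)).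
elim: k Y UY => // k IHk Y UY Yk.
have [_ S1 SM _] := is_subgroup_family_stabilizer G P F.
(* Two vectors of the same cone have positive product, so the absolute value in the induction
   measure is harmless. *)
have YZ0 (X : 'rV[int]_n) : U (ext R X) -> 0 < lform G X Z.
  move=> [PX _]; have [PZ _] := UZ; move: PZ.
  by rewrite (positive_cone_mem GT hG hP PX) => -[_]; rewrite ext_form ltr0z.
have [[r [Ar rYZ]]|sep] :=
    pselect (exists r, A r /\ ~~ (0 < lform G Y r * lform G Z r)).
  have gr := reflection_stabilizer Ar.
  have UY' : U (ext R (Y *m reflection G r)).
    by rewrite -act_ext; exact: (family_stabilizer_complement gr UY).
  have Y0 : lform G Y r != 0.
    by have := complement_sign UY Ar; rewrite ext_form intr_eq0.
  have Z0 : lform G Z r != 0.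
    by have := complement_sign UZ Ar; rewrite ext_form intr_eq0.
  have [|g hg gA] := IHk _ UY'; last first.
    by exists (reflection G r *m g); [exact: SM | move=> s /gA; rewrite mulmxA].
  have := YZ0 _ UY'; have := YZ0 _ UY.
  (* The new product is <Y, Z> + <Y, r> <Z, r>; the added term is negative, as neither factor
     vanishes off the mirrors. *)
  rewrite mul_reflection lformDl lformZl (lform_sym r Z GT).
  have : lform G Y r * lform G Z r < 0.
    by rewrite lt_neqAle mulf_neq0 //= leNgt.
  by move: Yk; lia.
exists 1%:M => // r Ar; rewrite mulmx1; apply/negPn/negP => h; apply: sep.
by exists r.
Qed.

(** Each component contains an integral point. Once a group element has given Y the signs of Z at
    every root of [A], both lie in one component, so the chambers agree. *)
Lemma reflections_simple_tessellation : simple_tessellation G P F.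
Proof.
exists (family_stabilizer G P F); split=> [|g []//|D D' [x Ux ->] [x' Ux' ->]].
  exact: is_subgroup_family_stabilizer.
have ipt z : U z -> exists Y : 'rV[int]_n,
    U (ext R Y) /\ connected_component U z = connected_component U (ext R Y).
  move=> Uz; have [Y [PY zY]] :=
    integral_point GT hG hP AG Uz.1 (fun r => complement_sign Uz).
  have zYU := same_sign_component GT hG hP Uz.1 PY zY.
  exists Y; split; last exact: same_connected_component.
  exact: connected_component_sub zYU.
have [Y [UY ->]] := ipt x Ux; have [Z [UZ ->]] := ipt x' Ux'.
have [g gS gA] := stabilizer_same_sign UY UZ.
exists g => //; rewrite (family_stabilizer_chamber gS UY) act_ext.
have [PY _] := family_stabilizer_complement gS UY; rewrite act_ext in PY.
rewrite (@same_connected_component _ _ _ (ext R Z)) //.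
apply: (same_sign_component GT hG hP) => // [|r Ar]; first by case: UZ.
by rewrite !ext_form -intrM ltr0z gA.
Qed.

End Transitivity.

(** * Induced hyperplanes as mirrors of roots *)

Lemma root_hyperplane_nonempty (R : realType) (n : nat) (G : 'M[int]_n)
    (P : set 'rV[R]_n) (r : 'rV[int]_n) : G^T = G -> hyperbolic R G ->
  positive_cone G P -> Defs.roots G r -> hyperplane G P (ext R r) !=set0.
Proof.
move=> GT hG hP rr; have [x x0 PE] := hP.
have Px : P x by rewrite PE; exact: connected_component_refl.
have rrR : rform G (ext R r) (ext R r) = -2 by rewrite ext_form rr.
have qx : 0 < rform G x x by [].
(* The orthogonal projection of x to the mirror; its norm and its product with x are both <x, x> +
   a^2 / 2. *)
pose a := rform G x (ext R r); exists (x + (a / 2) *: ext R r); split.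
  rewrite (positive_cone_mem GT hG hP Px) /= /rform.
  rewrite !(lformDl, lformDr) !(lformZl, lformZr) -!/(rform _ _ _) rrR.
  rewrite (rform_sym (ext R r) x GT) -/a.
  by have := sqr_ge0 a; split; lra.
rewrite /rform lformDl lformZl -!/(rform _ _ _) rrR -/a.
by field.
Qed.

Lemma root_hyperplane_proper (R : realType) (n : nat) (G : 'M[int]_n)
    (P : set 'rV[R]_n) (r : 'rV[int]_n) : G^T = G -> hyperbolic R G ->
  positive_cone G P -> Defs.roots G r -> hyperplane G P (ext R r) `<` P.
Proof.
move=> GT hG hP rr; split; first by move=> x [].
move=> PH; have [x x0 PE] := hP.
have Px : P x by rewrite PE; exact: connected_component_refl.
have rrR : rform G (ext R r) (ext R r) = -2 by rewrite ext_form rr.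
have [_ xr] := PH x Px; have qx : 0 < rform G x x by [].
(* With k <x, x> = <x, x> + 2 and k > 1, the norm k^2 <x, x> - 2 of k x + r is positive, while its
   product with r is -2. *)
pose k := 1 + 2 / rform G x x.
have kE : k * rform G x x = rform G x x + 2 by rewrite /k; field; rewrite gt_eqF.
have k1 : 1 < k by rewrite /k ltrDl divr_gt0.
have /PH[_] : P (k *: x + ext R r).
  rewrite (positive_cone_mem GT hG hP Px) /= /rform.
  rewrite !(lformDl, lformDr) !(lformZl, lformZr) -!/(rform _ _ _) rrR.
  rewrite (rform_sym (ext R r) x GT) xr kE; split; last by lra.
  by nra.
rewrite /rform lformDl lformZl -!/(rform _ _ _) rrR xr; lra.
Qed.

(* x is such that x / 2 is the orthogonal projection of r to L (x) Q, for
   f : L(2) -> M, G the form of L and H the form of M. *)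
Definition projects_to (m n : nat) (G : 'M[int]_m) (H : 'M[int]_n)
    (f : 'M[int]_(m, n)) (r : 'rV[int]_n) (x : 'rV[int]_m) : Prop :=
  f *m H *m r^T = G *m x^T.

Lemma lform_projects_to (m n : nat) (G : 'M[int]_m) (H : 'M[int]_n)
    (f : 'M[int]_(m, n)) (r : 'rV[int]_n) (x v : 'rV[int]_m) :
  projects_to G H f r x -> lform H (v *m f) r = lform G v x.
Proof.
by move=> rx; rewrite /lform -2!(mulmxA v) rx -mulmxA.
Qed.

Lemma rform_projects_to (R : realType) (m n : nat) (G : 'M[int]_m)
    (H : 'M[int]_n) (f : 'M[int]_(m, n)) (r : 'rV[int]_n) (x : 'rV[int]_m)
    (v : 'rV[R]_m) :
  projects_to G H f r x -> rform H (act f v) (ext R r) = rform G v (ext R x).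
Proof.
move=> rx; rewrite /rform /lform /act -2!(mulmxA v) -!ext_trmx -!ext_mul rx.
by rewrite ext_mul mulmxA.
Qed.

Lemma hyperplane_preimage (R : realType) (m n : nat) (G : 'M[int]_m)
    (H : 'M[int]_n) (f : 'M[int]_(m, n)) (P : set 'rV[R]_m)
    (P' : set 'rV[R]_n) (r : 'rV[int]_n) (x : 'rV[int]_m) :
  [set act f x | x in P] `<=` P' -> projects_to G H f r x ->
  P `&` act f @^-1` hyperplane H P' (ext R r) = hyperplane G P (ext R x).
Proof.
move=> fP rx; apply/seteqP; split=> p; rewrite /hyperplane /preimage /=.
  by rewrite (rform_projects_to _ rx) => -[? []].
by rewrite (rform_projects_to _ rx) => -[Pp]; do 2!split=> //; apply: fP; exists p.
Qed.

(** Norm -2 is imposed on x as well as on r: [induced_hyperplanesE] shows that no other x gives a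
    nonempty proper hyperplane. *)
Definition projected_roots (m n : nat) (G : 'M[int]_m) (H : 'M[int]_n)
    (f : 'M[int]_(m, n)) : set 'rV[int]_m :=
  [set x | Defs.roots G x /\ exists2 r, Defs.roots H r & projects_to G H f r x].

(* With b = <r, t> and k = <x, y>, the product of the reflections in x and in
   the component of r orthogonal to L(2) preserves M and maps t to
   t + (2b - k) r + (k - b) f(x), which projects to y + k x. *)
Lemma projected_roots_reflection (m n : nat) (G : 'M[int]_m) (H : 'M[int]_n)
    (f : 'M[int]_(m, n)) (x y : 'rV[int]_m) : G^T = G -> H^T = H ->
  (forall u v, lform H (u *m f) (v *m f) = lform (2 *: G) u v) ->
  projected_roots G H f x -> projected_roots G H f y ->
  projected_roots G H f (y + lform G y x *: x).
Proof.
move=> GT HT fE [xx [r rr rx]] [yy [t tt ty]].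
have fHf : f *m H *m f^T = 2 *: G.
  by apply: form_gram => u v; rewrite -fE /lform trmx_mul !mulmxA.
set k := lform G y x; split.
  rewrite /Defs.roots /= !(lformDl, lformDr) !(lformZl, lformZr) xx yy.
  by rewrite (lform_sym x y GT) -/k; ring.
pose b := lform H r t.
exists (t + (2 * b - k) *: r + (k - b) *: (x *m f)); last first.
  rewrite /projects_to !(linearD, linearZ) /= trmx_mul.
  rewrite mulmxA fHf rx ty -scalemxAl scalerA -addrA -scalerDl.
  by congr (_ + _ *: _); ring.
have xfr : lform H (x *m f) r = -2 by rewrite (lform_projects_to x rx).
have xft : lform H (x *m f) t = k.
  by rewrite (lform_projects_to x ty) lform_sym.
have xfxf : lform H (x *m f) (x *m f) = -4.
  by rewrite fE /lform -scalemxAr -scalemxAl mxE -/(lform G x x) xx.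
rewrite /Defs.roots /= !(lformDl, lformDr) !(lformZl, lformZr).
rewrite (lform_sym t (x *m f) HT) (lform_sym r (x *m f) HT) (lform_sym t r HT).
by rewrite xfr xft xfxf rr tt -/b; ring.
Qed.

Lemma induced_hyperplanesE (R : realType) (m n : nat) (G : 'M[int]_m)
    (H : 'M[int]_n) (f : 'M[int]_(m, n)) (P : set 'rV[R]_m)
    (P' : set 'rV[R]_n) :
  even_unimodular_hyperbolic R G -> H^T = H -> hyperbolic R H ->
  positive_cone G P -> [set act f x | x in P] `<=` P' ->
  primitive_embedding (2 *: G) H f ->
  induced_hyperplanes H P P' f =
  [set hyperplane G P (ext R x) | x in projected_roots G H f].
Proof.
move=> [/lattice_trmx GT evG uG hG] HT hH hP fP [[_ fE] prf].
have f2 u v : lform H (u *m f) (v *m f) = 2 * lform G u v.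
  by rewrite fE /lform -scalemxAr -scalemxAl mxE.
apply/seteqP; split=> [K [_ [[r rr <-] -> Kn Kp]]|_ [x [xx [r rr rx]] <-]].
  (* Unimodularity of G makes the solution of [projects_to] integral. *)
  pose x := (invmx G *m f *m H *m r^T)^T.
  have rx : projects_to G H f r x by rewrite /projects_to trmxK -!mulmxA mulKVmx.
  rewrite (hyperplane_preimage fP rx) in Kn Kp *.
  exists x => //; split; last by exists r.
  have [p [Pp px]] := Kn.
  have qp : 0 < rform G p p.
    by move: (Pp); rewrite (positive_cone_mem GT hG hP Pp) => -[].
  have x0 : x != 0.
    apply/eqP => x0; case: Kp => _; apply=> q Pq; split=> //.
    by rewrite x0 /ext map_mx0 /rform /lform trmx0 mulmx0 mxE.
  have ext0 (k : nat) (v : 'rV[int]_k) : v != 0 -> ext R v != 0.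
    apply: contra_neq => /rowP v0; apply/rowP => j; have := v0 j.
    by rewrite !mxE => /eqP; rewrite intr_eq0 => /eqP.
  have xneg : lform G x x < 0.
    have := timelike_orthogonal_lt0 hG qp px (ext0 _ _ x0).
    by rewrite ext_form ltrz0.
  (* Twice the component of r orthogonal to the image of f. *)
  pose u := 2 *: r - x *m f.
  have [u0|un0] := eqVneq u 0.
    (* Here 2 r = f(x), so primitivity gives r = f(z) with 2 <z, z> = -2, against evenness. *)
    have [z zE] : exists z, r = z *m f.
      by apply: (prf 2) => //; exists x; apply/eqP; rewrite -subr_eq0 -/u u0.
    have := evG z; move: rr; rewrite zE /Defs.roots /= f2 => /eqP.
    rewrite (_ : -2 = 2 * -1) // (inj_eq (mulfI _)) // => /eqP -> //.
  have qp' : 0 < rform H (act f p) (act f p).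
    rewrite (_ : rform H _ _ = 2 * rform G p p) ?mulr_gt0 //.
    rewrite (rform_act _ _ fE) /rform /lform /ext map_mxZ.
    by rewrite -scalemxAr -scalemxAl mxE.
  have xfx : projects_to (2 *: G) H f (x *m f) x.
    rewrite /projects_to trmx_mul mulmxA; congr (_ *m _).
    by apply: form_gram => a b; rewrite -fE /lform trmx_mul !mulmxA.
  have pu : rform H (act f p) (ext R u) = 0.
    rewrite /u /ext map_mxB map_mxZ -scaleN1r /rform lformDr !lformZr.
    rewrite -!/(ext R _) -!/(rform _ _ _).
    rewrite (rform_projects_to _ rx) (rform_projects_to _ xfx) px mulr0 add0r.
    rewrite /rform /lform /ext map_mxZ -scalemxAr -scalemxAl mxE.
    by rewrite -/(ext R _) -/(ext R _) -/(lform _ _ _) -/(rform _ _ _) px !mulr0.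
  have := timelike_orthogonal_lt0 hH qp' pu (ext0 _ _ un0).
  rewrite ext_form ltrz0 /u -scaleN1r !(lformDl, lformDr) !(lformZl, lformZr).
  rewrite rr f2 (lform_sym r _ HT) (lform_projects_to x rx).
  move: (evG x) xneg; rewrite /Defs.roots /=.
  (* The norm of u is -8 - 2q < 0, so q > -4; being even and negative, q is -2. *)
  by set q := lform G x x => /dvdzP[c ->]; lia.
(* Conversely, the mirror of a root x always meets P and never fills it. *)
exists (hyperplane H P' (ext R r)); split; first by exists r.
- by rewrite (hyperplane_preimage fP rx).
- exact: root_hyperplane_nonempty.
- exact: root_hyperplane_proper.
Qed.

Theorem corollary1p11 (R : realType)
    (L10 : 'M[int]_10) (L26 : 'M[int]_26)
    (hL10 : even_unimodular_hyperbolic R L10)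
    (hL26 : even_unimodular_hyperbolic R L26)
    (P10 : set 'rV[R]_10) (P26 : set 'rV[R]_26)
    (hP10 : positive_cone L10 P10) (hP26 : positive_cone L26 P26)
    (iota : 'M[int]_(10, 26))
    (hiota : primitive_embedding (2 *: L10) L26 iota)
    (hcone : [set act iota x | x in P10] `<=` P26)
    (hninf : ~ type_infty L26 iota) :
  simple_tessellation L10 P10 (induced_hyperplanes L26 P10 P26 iota).
Proof.
have [/lattice_trmx G26 _ _ h26] := hL26.
have [/lattice_trmx G10 _ _ h10] := hL10.
rewrite (induced_hyperplanesE hL10 G26 h26 hP10 hcone hiota).
apply: reflections_simple_tessellation => // [x []//|x y].
exact: projected_roots_reflection G10 G26 hiota.1.2.
Qed.
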